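(* Let $a,b\ge1$ be integers, $g=\gcd(a,b)$, and let $I\subset K[x,y]$ be the monomial ideal with $G(I)=\{x^{i\frac ag}y^{b-i\frac bg} : i\in A\}$, where $\{0,g\}\subseteq A\subseteq[0,g]$. Then $$r(I)\le \frac{g}{\gcd(A)}-|A|+2.$$
   Context: $K$ is a field. For a monomial ideal $I\subset K[x,y]$, $G(I)$ is its unique minimal set of monomial generators. With $J=(x^a,y^b)$, the reduction number $r(I)$ is the smallest integer $r\ge0$ with $I^{r+1}=JI^r$ (such $r$ exists for the ideals considered). $[c,d]$ denotes the set of integers $i$ with $c\le i\le d$, $\gcd(A)$ is the greatest common divisor of the integers in $A$, and $|A|$ is the cardinality of $A$. *)

(* Defs.v *)
From mathcomp Require Import all_boot all_algebra.
From mathcomp Require Import classical_sets.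
From mathcomp Require Import mpoly.

Set Implicit Arguments.
Unset Strict Implicit.
Unset Printing Implicit Defensive.

Import GRing.Theory.

Local Open Scope classical_set_scope.
Local Open Scope ring_scope.

Section Ideals.
Variable R : comNzRingType.
Implicit Types (I J S : set R).

Definition is_ideal I : Prop :=
  [/\ I 0, forall p q, I p -> I q -> I (p + q) & forall p q, I q -> I (p * q)].

Definition ideal_gen S : set R := smallest is_ideal S.

Definition ideal_mul I J : set R :=
  ideal_gen [set f | exists p q, [/\ I p, J q & f = p * q]].

Fixpoint ideal_exp I (n : nat) : set R :=
  if n is m.+1 then ideal_mul I (ideal_exp I m) else setT.

(* The set of admissible exponents may be empty for arbitrary [J] and [I], so
   "the reduction number of [I] with respect to [J] is [r]" is a relation. *)
Definition reduction_number J I (r : nat) : Prop :=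
  ideal_exp I r.+1 = ideal_mul J (ideal_exp I r) /\
  forall s : nat, ideal_exp I s.+1 = ideal_mul J (ideal_exp I s) -> (r <= s)%N.

End Ideals.

Definition is_monomial (n : nat) (K : fieldType) (f : {mpoly K[n]}) : Prop :=
  exists m : 'X_{1..n}, f = 'X_[m].

(* [I] is a monomial ideal and [G] = G(I): minimality is with respect to
   inclusion among the sets of monomials that generate [I]. *)
Definition minimal_monomial_generators (n : nat) (K : fieldType)
    (I G : set {mpoly K[n]}) : Prop :=
  [/\ G `<=` @is_monomial n K, I = ideal_gen G &
      forall H : set {mpoly K[n]}, H `<=` G -> I = ideal_gen H -> H = G].

Definition xvar (K : fieldType) : {mpoly K[2]} := 'X_ord0.
Definition yvar (K : fieldType) : {mpoly K[2]} := 'X_ord_max.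

Definition gcd_set (n : nat) (A : {set 'I_n}) : nat :=
  \big[gcdn/0%N]_(i in A) (i : nat).

(* Main.v *)
Require Import Defs.
From mathcomp Require Import all_boot all_algebra.
From mathcomp Require Import classical_sets boolp.
From mathcomp Require Import mpoly.
From mathcomp Require Import zify.

Set Implicit Arguments.
Unset Strict Implicit.
Unset Printing Implicit Defensive.

Import GRing.Theory Num.Theory.

(** The generators [x ^ (i a/g) y ^ (b - i b/g)] lie on a line, so a product of
    [n] of them depends only on [n] and on the sum of the indices [i]. Hence
    [I ^ n] is generated by monomials labelled by the [n]-fold sumset [nA], and
    [x ^ a], [y ^ b] are the generators with the extreme labels [g] and [0]. For
    [I ^ n.+1 = J I ^ n] it therefore suffices that each sum of [n + 1] elements
    of [A] is also a sum of [n + 1] elements of [A] one of which is [0] or [g].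

    Call a sequence in [A] bad if its sum admits no such rewriting. The subsequences
    of a bad sequence are bad too. A bad sequence of positive length cannot have
    a sum divisible by [g]: a sum [k g] of [l] elements of [A] is made of [k]
    copies of [g] and [l - k] copies of [0]. A bad sequence of length [l >= 2]
    cannot have a sum congruent modulo [g] to some [c] in [A] with [0 < c < g]:
    this sum is [c + k g] with [k <= l - 1], which is made of [c], [k] copies of
    [g] and [l - 1 - k] copies of [0] ([block_with_endpoint]). So, for a bad
    sequence of length [r], the partial sums of lengths [2, ..., r] are pairwise
    distinct modulo [g], as the difference of two of them is the sum of a block,
    and they avoid the [#|A| - 1] residues of [A]. All these residues are
    multiples of [d = gcd A], and there are only [g / d] such classes, whence
    [(r - 1) + (#|A| - 1) <= g / d] ([sum_with_endpoint]). Thus the equation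
    [I ^ n.+1 = J I ^ n] holds at [n = g / d - #|A| + 2], and the least exponent
    at which it holds is at most this. *)

(** * Sums of elements of a set of integers *)

Lemma sumn_leq_size (g : nat) (u : seq nat) :
  {in u, forall c, c <= g} -> sumn u <= size u * g.
Proof.
elim: u => //= c u IH hu; rewrite mulSn leq_add ?hu ?mem_head //.
by apply: IH => e eu; rewrite hu // inE eu orbT.
Qed.

(** A sum of [l] elements of [A] that is congruent to [c] modulo [g] equals
    [c + k g], and as it is at most [l g], the copies of [g] leave room for [c]
    and for zeros. For [c != 0] one of the [l] places is taken by [c] itself,
    hence the requirement [1 < l] in that case. *)
Lemma block_with_endpoint (A u : seq nat) (g c : nat) :
  0 < g -> {in A, forall e, e <= g} -> 0 \in A -> g \in A -> {subset u <= A} ->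
  c \in A -> sumn u %% g = c -> (c == 0) && (0 < size u) || (1 < size u) ->
  exists v, [/\ {subset v <= A}, size v = size u, sumn v = sumn u
            & (0 \in v) || (g \in v)].
Proof.
move=> g0 Ag A0 Agm uA cA uc hsz.
have su : sumn u <= size u * g by apply: sumn_leq_size => e /uA /Ag.
have cg : c < g by rewrite -uc ltn_pmod.
have eu : sumn u = sumn u %/ g * g + c by rewrite {1}(divn_eq (sumn u) g) uc.
set k := sumn u %/ g in eu.
have hends l : k <= l -> 0 < l ->
    (0 \in nseq k g ++ nseq (l - k) 0) || (g \in nseq k g ++ nseq (l - k) 0).
  move=> kl l0; rewrite !mem_cat !mem_nseq !eqxx !andbT.
  by case: (posnP k) => [-> | _]; rewrite ?subn0 ?l0 ?orbT.
have hsub l : {subset nseq k g ++ nseq (l - k) 0 <= A}.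
  by move=> e; rewrite mem_cat !mem_nseq => /orP[]/andP[_ /eqP->].
have [c0 | c0] := posnP c.
  have kl : k <= size u by rewrite -(leq_pmul2r g0); lia.
  exists (nseq k g ++ nseq (size u - k) 0); split=> //.
  - by rewrite size_cat !size_nseq subnKC.
  - by rewrite sumn_cat !sumn_nseq; lia.
  - by apply: hends => //; move: hsz; lia.
have kl : k < size u by rewrite -(ltn_pmul2r g0); lia.
exists (c :: nseq k g ++ nseq ((size u).-1 - k) 0); split.
- by move=> e; rewrite inE => /predU1P[-> // | /hsub].
- by rewrite /= size_cat !size_nseq; lia.
- by rewrite /= sumn_cat !sumn_nseq; lia.
- have /orP[h | h] : (0 \in nseq k g ++ nseq ((size u).-1 - k) 0) ||
    (g \in nseq k g ++ nseq ((size u).-1 - k) 0).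
  + by apply: hends; lia.
  + by rewrite inE h orbT.
  + by rewrite [g \in _]inE h !orbT.
Qed.

Lemma size_residues_leq (g d : nat) (l : seq nat) :
  0 < g -> d %| g -> uniq l -> {in l, forall c, c < g /\ d %| c} ->
  size l <= g %/ d.
Proof.
move=> g0 dg ul hl.
have d0 : 0 < d by apply: dvdn_gt0 dg.
rewrite -(size_iota 0 (g %/ d)) -(size_map (muln d) (iota _ _)).
apply: uniq_leq_size => // c /hl[cg dc].
apply/mapP; exists (c %/ d); last by rewrite mulnC divnK.
by rewrite mem_iota add0n /= ltn_divLR // divnK.
Qed.

(** Pigeonhole on the residues modulo [g] of the partial sums of [s] of length at
    least 2, together with the residues of [A]: a coincidence produces a block of
    [s] to which [block_with_endpoint] applies. *)
Lemma sum_with_endpoint (A s : seq nat) (g d : nat) :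
  0 < g -> uniq A -> {in A, forall c, c <= g} -> 0 \in A -> g \in A ->
  {in A, forall c, d %| c} -> {subset s <= A} ->
  g %/ d + 2 < size s + size A ->
  exists t, [/\ {subset t <= A}, size t = size s, sumn t = sumn s
            & (0 \in t) || (g \in t)].
Proof.
move=> g0 uA Ag A0 Agm dA sA hsz.
have dg := dA _ Agm.
have replace_block s1 u s2 c : s = s1 ++ u ++ s2 -> c \in A ->
    sumn u %% g = c -> (c == 0) && (0 < size u) || (1 < size u) ->
    exists t, [/\ {subset t <= A}, size t = size s, sumn t = sumn s
            & (0 \in t) || (g \in t)].
  move=> es cA uc cu.
  have uA' : {subset u <= A}.
    by move=> e eu; apply: sA; rewrite es !mem_cat eu orbT.
  have [v [vA vsz vs vend]] := block_with_endpoint g0 Ag A0 Agm uA' cA uc cu.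
  exists (s1 ++ v ++ s2); split.
  - move=> e; rewrite !mem_cat => /or3P[h | /vA // | h];
      by apply: sA; rewrite es !mem_cat h ?orbT.
  - by rewrite es !size_cat vsz.
  - by rewrite es !sumn_cat vs.
  - by case/orP: vend => h; rewrite !mem_cat h !orbT.
pose psum m := sumn (take m s) %% g.
pose ps := [seq psum m | m <- iota 2 (size s).-1].
have d_sum u : {subset u <= A} -> d %| sumn u.
  elim: u => // e u IH uA'; rewrite /= dvdn_add //.
    by apply/dA/uA'; rewrite mem_head.
  by apply: IH => z zu; apply: uA'; rewrite inE zu orbT.
have szA : size (rem g A) = (size A).-1 by rewrite size_rem.
have A_gt0 : 0 < size A by case: (A) A0.
have hall : {in ps ++ rem g A, forall c, c < g /\ d %| c}.
  move=> c; rewrite mem_cat => /orP[/mapP[m _ ->] | ].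
    rewrite ltn_pmod //; split=> //; rewrite /psum /dvdn modn_dvdm //.
    by apply: d_sum => e /mem_take /sA.
  by rewrite mem_rem_uniq // inE => /andP[/= cg cA]; rewrite ltn_neqAle cg Ag ?dA.
(* [g] is left out of [A] because it has the same residue as [0]. *)
have : ~~ uniq (ps ++ rem g A).
  apply/negP => /(size_residues_leq g0 dg) /(_ hall).
  by rewrite size_cat size_map size_iota szA; lia.
rewrite cat_uniq (rem_uniq _ uA) andbT negb_and negbK => /orP[nups | ].
  (* Two congruent partial sums: the block between them sums to [0] mod [g]. *)
  have [i [j [ij]]] : exists i j, [/\ i < j, j < size ps & nth 0 ps i = nth 0 ps j].
    by have /(uniqPn 0)[i [j [? ? ?]]] := nups; exists i, j.
  rewrite size_map size_iota => jsz.
  rewrite !(nth_map 0) ?size_iota ?(ltn_trans ij) // !nth_iota ?(ltn_trans ij) //.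
  rewrite /psum => eij.
  pose u := drop (2 + i) (take (2 + j) s).
  have eu : take (2 + j) s = take (2 + i) s ++ u.
    by rewrite -(cat_take_drop (2 + i) (take (2 + j) s)) take_takel //; lia.
  apply: (replace_block (take (2 + i) s) u (drop (2 + j) s) 0) => //.
  - by rewrite catA -eu cat_take_drop.
  - apply/eqP; rewrite -[X in _ == X](mod0n g).
    by rewrite -(eqn_modDl (sumn (take (2 + i) s))) addn0 -sumn_cat -eu eij.
  - by rewrite size_drop size_takel; lia.
(* A partial sum congruent to an element of [A]: the block is this initial
   segment, which has length at least 2. *)
case/hasP => c; rewrite mem_rem_uniq // inE => /andP[/= _ cA] /mapP[m].
rewrite mem_iota => hm ec.
apply: (replace_block [::] (take m s) (drop m s) c) => //.
- by rewrite /= cat_take_drop.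
- by rewrite size_takel; lia.
Qed.

Local Open Scope classical_set_scope.
Local Open Scope ring_scope.

(** * Generators of products and powers of ideals *)

Lemma ideal_gen_ideal (R : comNzRingType) (S : set R) : is_ideal (ideal_gen S).
Proof.
split.
- by move=> J [[J0 _ _] _].
- by move=> p q hp hq J JS; case: (JS) => -[_ Jadd _] _; apply: Jadd; [apply: hp | apply: hq].
- by move=> p q hq J JS; case: (JS) => -[_ _ Jmul] _; apply: Jmul; apply: hq.
Qed.

Lemma ideal_mul_gen (R : comNzRingType) (S T : set R) :
  ideal_mul (ideal_gen S) (ideal_gen T) =
  ideal_gen [set f | exists p q, [/\ S p, T q & f = p * q]].
Proof.
set U := [set f | _]; have [U0 Uadd Umul] := ideal_gen_ideal U.
apply/seteqP; split; apply: smallest_sub; try exact: ideal_gen_ideal.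
  move=> _ [p [q [hp hq ->]]].
  move: p hp q hq.
  have hS p : S p -> forall q, ideal_gen T q -> ideal_gen U (p * q).
    move=> Sp; apply: (@smallest_sub _ _ _ [set q | ideal_gen U (p * q)]).
      split=> /=.
      - by rewrite mulr0.
      - by move=> q q' hq hq'; rewrite mulrDr; apply: Uadd.
      - by move=> q q' hq'; rewrite mulrCA; apply: Umul.
    by move=> q Tq; apply: sub_gen_smallest; exists p, q.
  apply: (@smallest_sub _ _ _
    [set p | forall q, ideal_gen T q -> ideal_gen U (p * q)]) => //.
  split=> /=.
  - by move=> q _; rewrite mul0r.
  - by move=> p p' hp hp' q hq; rewrite mulrDl; apply: Uadd; [apply: hp | apply: hp'].
  - by move=> p p' hp' q hq; rewrite -mulrA; apply: Umul; apply: hp'.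
move=> _ [p [q [hp hq ->]]]; apply: sub_gen_smallest; exists p, q.
by split=> //; apply: sub_gen_smallest.
Qed.

(** The generators are indexed by a type [T] so that the powers are described by
    sequences of indices, on which the combinatorics of sums can act. *)
Lemma ideal_exp_gen (R : comNzRingType) (T : eqType) (w : T -> R) (A : seq T)
    (n : nat) :
  ideal_exp (ideal_gen [set f | exists2 i, i \in A & f = w i]) n =
  ideal_gen [set f | exists s : seq T,
    [/\ {subset s <= A}, size s = n & f = \prod_(i <- s) w i]].
Proof.
elim: n => [|n IH] /=.
  apply/seteqP; split=> // p _; rewrite -[p]mulr1.
  have [_ _ gmul] := ideal_gen_ideal [set f | exists s : seq T,
    [/\ {subset s <= A}, size s = 0%N & f = \prod_(i <- s) w i]].
  by apply: gmul; apply: sub_gen_smallest; exists [::]; rewrite big_nil.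
rewrite IH ideal_mul_gen; congr ideal_gen; apply/seteqP; split=> f.
  move=> [_ [_ [[i iA ->] [s [sA sn ->]] ->]]].
  exists (i :: s); rewrite big_cons /= sn; split=> // e.
  by rewrite inE => /predU1P[-> // | /sA].
move=> [[|i s] [sA //= [sn] ->]]; exists (w i), (\prod_(j <- s) w j).
rewrite big_cons; split=> //; first by exists i => //; apply: sA; rewrite mem_head.
by exists s; split=> // e es; apply: sA; rewrite inE es orbT.
Qed.

(** The truncated subtractions are exact because [c <= g] for every index. *)
Lemma prod_collinear (R : comNzRingType) (x y : R) (a' b' g : nat)
    (s : seq nat) :
  {in s, forall c, c <= g}%N ->
  \prod_(i <- s) (x ^+ (i * a') * y ^+ (g * b' - i * b')) =
  x ^+ (sumn s * a') * y ^+ (size s * (g * b') - sumn s * b').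
Proof.
elim: s => [|c s IH] hs; first by rewrite big_nil /= !mul0n !expr0 mulr1.
have hs' : {in s, forall e, e <= g}%N by move=> e es; rewrite hs // inE es orbT.
have hc : (c * b' <= g * b')%N by rewrite leq_mul2r hs ?mem_head ?orbT.
have hS : (sumn s * b' <= size s * (g * b'))%N.
  by rewrite mulnA leq_mul2r sumn_leq_size ?orbT.
rewrite big_cons IH //= mulrACA -!exprD mulnDl mulSn.
by congr (_ * _ ^+ _); rewrite mulnDl; lia.
Qed.

(** * The reduction number *)

(** Both sides are generated by products of [n + 1] generators, on the right
    with one factor of index [0] or [g]; [sum_with_endpoint] rewrites a product
    of the first kind as one of the second without changing the sum of the
    indices, hence without changing the monomial. *)
Lemma ideal_exp_stable (R : comNzRingType) (x y : R) (a' b' g d n : nat)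
    (A : seq nat) (w := fun i : nat => x ^+ (i * a') * y ^+ (g * b' - i * b')) :
  (0 < g)%N -> uniq A -> {in A, forall c, c <= g}%N -> 0%N \in A -> g \in A ->
  {in A, forall c, d %| c}%N -> (g %/ d + 2 <= n + size A)%N ->
  let I := ideal_gen [set f | exists2 i, i \in A & f = w i] in
  ideal_exp I n.+1 = ideal_mul (ideal_gen [set w g; w 0%N]) (ideal_exp I n).
Proof.
move=> g0 uA Ag A0 Agm dA hn I.
rewrite !ideal_exp_gen ideal_mul_gen; congr ideal_gen; apply/seteqP; split=> f.
  move=> [s [sA sn ->]].
  have [|t [tA tsz ts tend]] := sum_with_endpoint g0 uA Ag A0 Agm dA sA.
    by rewrite sn.
  have -> : \prod_(i <- s) w i = \prod_(i <- t) w i.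
    by rewrite !prod_collinear ?ts ?tsz // => e; [move/tA/Ag | move/sA/Ag].
  have [e et we] : exists2 e, e \in t & [set w g; w 0%N] (w e).
    by case/orP: tend => h; [exists 0%N => //; right | exists g => //; left].
  exists (w e), (\prod_(i <- rem e t) w i); split=> //.
    exists (rem e t); split=> //; first by move=> i /mem_rem /tA.
    by rewrite size_rem // tsz sn.
  by rewrite (perm_big _ (perm_to_rem et)) big_cons.
have step e s : e \in A -> {subset s <= A} -> size s = n ->
    exists s', [/\ {subset s' <= A}, size s' = n.+1
      & w e * \prod_(i <- s) w i = \prod_(i <- s') w i].
  move=> eA sA sn; exists (e :: s); rewrite big_cons /= sn; split=> // i.
  by rewrite inE => /predU1P[-> // | /sA].
by move=> [_ [_ [[->|->] [s [sA sn ->]] ->]]]; apply: step.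
Qed.

Lemma dvdn_gcd_set (n : nat) (A : {set 'I_n}) (i : 'I_n) :
  i \in A -> (gcd_set A %| i)%N.
Proof. by move=> iA; rewrite /gcd_set (bigD1 i) //= dvdn_gcdl. Qed.

Theorem theorem2p2 (K : fieldType) (a b g : nat)
    (ha : (1 <= a)%N) (hb : (1 <= b)%N) (hg : g = gcdn a b)
    (A : {set 'I_g.+1}) (hA0 : ord0 \in A) (hAg : ord_max \in A)
    (I : set {mpoly K[2]})
    (hI : minimal_monomial_generators I
       [set f | exists2 i : 'I_g.+1, i \in A &
          f = xvar K ^+ (i * (a %/ g)) * yvar K ^+ (b - i * (b %/ g))]) :
  exists r : nat,
    reduction_number (ideal_gen [set xvar K ^+ a; yvar K ^+ b]) I r /\
    (r%:Z <= (g %/ gcd_set A)%N%:Z - #|A|%:Z + 2).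
Proof.
have g0 : (0 < g)%N by rewrite hg gcdn_gt0 ha.
have ega : (g * (a %/ g) = a)%N by rewrite mulnC divnK // hg dvdn_gcdl.
have egb : (g * (b %/ g) = b)%N by rewrite mulnC divnK // hg dvdn_gcdr.
pose B := [seq val i | i <- enum A].
have uB : uniq B by rewrite (map_inj_uniq val_inj) enum_uniq.
have szB : size B = #|A| by rewrite size_map -cardE.
have memB (i : 'I_g.+1) : i \in A -> val i \in B.
  by move=> iA; rewrite map_f // mem_enum.
have Bg : {in B, forall c, c <= g}%N by move=> _ /mapP[i _ ->]; exact: leq_ord.
have dB : {in B, forall c, gcd_set A %| c}%N.
  by move=> _ /mapP[i iA ->]; apply: dvdn_gcd_set; rewrite -mem_enum.
have B0 : 0%N \in B := memB _ hA0.
have Bgm : g \in B := memB _ hAg.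
(* This makes the truncated subtraction in [n] below exact. *)
have cardA : (#|A| <= g %/ gcd_set A + 1)%N.
  suff : (size (rem g B) <= g %/ gcd_set A)%N by rewrite size_rem // szB; lia.
  apply: size_residues_leq => //; [exact: dB | exact: rem_uniq | move=> c].
  rewrite mem_rem_uniq // inE => /andP[/= cg cB].
  by rewrite ltn_neqAle cg Bg ?dB.
pose n := (g %/ gcd_set A + 2 - #|A|)%N.
set J := ideal_gen _; pose stable r := `[< ideal_exp I r.+1 = ideal_mul J (ideal_exp I r) >].
have stable_n : stable n.
  apply/asboolP.
  have hn : (g %/ gcd_set A + 2 <= n + size B)%N by rewrite szB /n; lia.
  have := ideal_exp_stable (xvar K) (yvar K) (a %/ g) (b %/ g)
    g0 uB Bg B0 Bgm dB hn.
  rewrite ega egb !mul0n subnn subn0 !expr0 mulr1 mul1r /=.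
  suff -> : [set f | exists2 i, i \in B
      & f = xvar K ^+ (i * (a %/ g)) * yvar K ^+ (b - i * (b %/ g))] =
    [set f | exists2 i : 'I_g.+1, i \in A
      & f = xvar K ^+ (i * (a %/ g)) * yvar K ^+ (b - i * (b %/ g))].
    by case: hI => _ <- _.
  apply/seteqP; split=> f; last by move=> [i iA ->]; exists (val i); rewrite ?memB.
  move=> [_ /mapP[i iA ->] ->]; exists i; last exact: erefl.
  by rewrite -mem_enum.
have [r /asboolP hr rmin] := ex_minnP (ex_intro _ n stable_n).
exists r; split; first by split=> // s hs; apply: rmin; apply/asboolP.
have : (r <= n)%N by exact: rmin.
by rewrite /n; clear -cardA; lia.
Qed.
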